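(* Let $\mathbb K$ be a discrete field and let $(W,\psi)$ be an algebraic flow over $\mathbb K$. Then $$\mathrm{ent}(W,\psi)=\mathrm{ent}^*(\widehat W,\widehat\psi).$$
   Context: An algebraic flow is a pair $(W,\psi)$ with $W$ a discrete $\mathbb K$-vector space and $\psi$ a linear endomorphism of $W$. A Hausdorff topological $\mathbb K$-space is linearly topologized if it has a neighbourhood basis at $0$ consisting of $\mathbb K$-subspaces; it is linearly compact if moreover any collection of closed linear varieties with the finite intersection property has non-empty intersection. The algebraic entropy of $(W,\psi)$ is $\mathrm{ent}(W,\psi)=\sup_U\lim_{n\to\infty}\frac1n\dim_{\mathbb K}\big((U+\psi U+\cdots+\psi^{n-1}U)/U\big)$, with $U$ ranging over the finite-dimensional subspaces of $W$ (which are the linearly compact open subspaces of the discrete space $W$). The topological entropy of a continuous linear endomorphism $\phi$ of a linearly compact space $V$ is $\mathrm{ent}^*(V,\phi)=\sup_U\lim_{n\to\infty}\frac1n\dim_{\mathbb K}\big(U/(U\cap\phi^{-1}U\cap\cdots\cap\phi^{-n+1}U)\big)$, with $U$ ranging over the linearly compact open subspaces of $V$. The Lefschetz dual $\widehat W$ of the discrete space $W$ is $\mathrm{Hom}_{\mathbb K}(W,\mathbb K)$ with the topology having the annihilators $A^\perp=\{\chi\mid\chi(A)=0\}$ of finite-dimensional subspaces $A\le W$ as a neighbourhood basis at $0$; it is linearly compact. The dual map is $\widehat\psi(\chi)=\chi\circ\psi$. *)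

(* Defs.v *)
From HB Require Import structures.
From mathcomp Require Import all_boot all_order all_algebra.
From mathcomp Require Import all_classical reals prodnormedzmodule.
(* The files on topological modules over numDomainTypes are deliberately not
   loaded here: their join of Nbhs and Lmodule is incompatible with one over an
   arbitrary fieldType. *)
From mathcomp Require Import ereal topology.

Set Implicit Arguments.
Unset Strict Implicit.
Unset Printing Implicit Defensive.

Import Order.TTheory GRing.Theory Num.Theory.

Local Open Scope classical_set_scope.
Local Open Scope ring_scope.

Section LinearAlgebra.
Context (K : fieldType) (V : lmodType K).
Implicit Types (A B C U : set V).

Definition linear_subspace U : Prop :=
  U 0 /\ forall (a : K) (x y : V), U x -> U y -> U (a *: x + y).

Definition lin_span n (v : 'I_n -> V) : set V :=
  [set \sum_i c i *: v i | c in [set: 'I_n -> K]].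

Definition fin_dim_subspace U : Prop :=
  exists n (v : 'I_n -> V), U = lin_span v.

(* A linear variety is a coset of a linear subspace. *)
Definition linear_variety C : Prop :=
  exists (x : V) (L : set V), linear_subspace L /\ C = [set x + y | y in L].

(* The classes of the v i form a basis of the quotient space A / B. *)
Definition quotient_basis A B n (v : 'I_n -> V) : Prop :=
  [/\ forall i, A (v i),
      forall c : 'I_n -> K, B (\sum_i c i *: v i) -> forall i, c i = 0 &
      forall x, A x -> exists c : 'I_n -> K, B (x - \sum_i c i *: v i)].

(* dim_K (A / B) for linear subspaces B <= A.  All finite bases of A / B have
   the same size, so the infimum is that size; it is over the empty set, hence
   +oo, when A / B has no finite basis. *)
Definition quotient_dim (R : realType) A B : \bar R :=
  ereal_inf [set (n%:R)%:E |
    n in [set n | exists v : 'I_n -> V, quotient_basis A B v]].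

(* U + f U + ... + f^(n-1) U *)
Definition trajectory (f : V -> V) U (n : nat) : set V :=
  [set \sum_(i < n) iter i f (u i) | u in [set u : 'I_n -> V | forall i, U (u i)]].

(* U `&` f^-1 U `&` ... `&` f^(-n+1) U *)
Definition cotrajectory (f : V -> V) U (n : nat) : set V :=
  \bigcap_(i in `I_n) (iter i f @^-1` U).

End LinearAlgebra.

(* The term n = 0 of the sequence is 0 (as 0^-1 = 0) and does not affect the
   limit. *)
Definition ent (R : realType) (K : fieldType) (W : lmodType K)
    (psi : {linear W -> W}) : \bar R :=
  ereal_sup [set lim ((fun n : nat =>
      ((n%:R)^-1)%:E * quotient_dim R (trajectory psi U n) U)%E @ \oo) |
    U in @fin_dim_subspace K W].

HB.mixin Record isTopologicalKspace (K : fieldType) V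
    & Topological V & GRing.Lmodule K V := {
  Kspace_add_continuous : continuous (fun p : V * V => p.1 + p.2) ;
  Kspace_scale_continuous :
    continuous (fun p : discrete_topology K * V => (p.1 : K) *: p.2)
}.

(* Topological K-spaces, for K with the discrete topology. *)
#[short(type="topKspaceType")]
HB.structure Definition TopKspace (K : fieldType) :=
  {V of Topological V & GRing.Lmodule K V & isTopologicalKspace K V}.

Section LinearTopology.
Context (K : fieldType) (V : topKspaceType K).
Implicit Types (U : set V).

(* The two predicates below concern a linear subspace U of V with the induced
   topology.  The points of [subspace U] outside U are isolated, so they affect
   neither separation nor the closed subsets of U. *)
Definition linearly_topologized U : Prop :=
  [/\ linear_subspace U,
      hausdorff_space (subspace U) &
      forall N : set (subspace U), nbhs (0 : subspace U) N ->
        exists L : set V, [/\ linear_subspace L, L `<=` U,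
          nbhs (0 : subspace U) (L : set (subspace U)) & L `<=` N]].

Definition linearly_compact U : Prop :=
  linearly_topologized U /\
  forall F : set (set V),
    (forall C, F C ->
       [/\ linear_variety C, C `<=` U & closed (C : set (subspace U))]) ->
    finI F id -> \bigcap_(C in F) C !=set0.

End LinearTopology.

Definition ent_star (R : realType) (K : fieldType) (V : topKspaceType K)
    (phi : {linear V -> V}) : \bar R :=
  ereal_sup [set lim ((fun n : nat =>
      ((n%:R)^-1)%:E * quotient_dim R U (cotrajectory phi U n))%E @ \oo) |
    U in [set U : set V | linearly_compact U /\ open U]].

Definition lefschetz_dual (K : fieldType) (W : lmodType K) := {scalar W}.

HB.instance Definition _ (K : fieldType) (W : lmodType K) :=
  Choice.copy (lefschetz_dual W) {linear W -> _ | *%R}.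

Section DualSpace.
Context (K : fieldType) (W : lmodType K).
Local Notation Wd := (lefschetz_dual W).
Implicit Types (chi eta : Wd).

Lemma dual_eqP chi eta : (forall x, chi x = eta x) -> chi = eta.
Proof.
case: chi eta => [f [[a] [b]]] [g [[c] [d]]] /= /funext fg.
case: _ / fg in c d *.
by rewrite (Prop_irrelevance a c) (Prop_irrelevance b d).
Qed.

Let dual_add chi eta : Wd := (chi : {scalar W}) \+ (eta : {scalar W}).
Let dual_zero : Wd := (\0 : W -> K) : {scalar W}.
Let mull_scalar (a : K) (chi : {scalar W}) (x : W) : K := a * chi x.
Let mull_scalar_is_scalar a chi : scalar (mull_scalar a chi).
Proof. by move=> b x y; rewrite /mull_scalar linearP mulrDr mulrCA. Qed.
HB.instance Definition _ a chi := GRing.isLinear.Build K W K *%R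
  (mull_scalar a chi) (mull_scalar_is_scalar a chi).
Let dual_scale (a : K) chi : Wd := mull_scalar a chi.
Let dual_opp chi : Wd := dual_scale (-1) chi.

Let dual_addA : associative dual_add.
Proof. by move=> f g h; apply: dual_eqP => x /=; rewrite addrA. Qed.
Let dual_addC : commutative dual_add.
Proof. by move=> f g; apply: dual_eqP => x /=; rewrite addrC. Qed.
Let dual_add0 : left_id dual_zero dual_add.
Proof. by move=> f; apply: dual_eqP => x /=; rewrite add0r. Qed.
Let dual_addN : left_inverse dual_zero dual_opp dual_add.
Proof. by move=> f; apply: dual_eqP => x /=; rewrite /mull_scalar mulN1r addNr. Qed.

HB.instance Definition _ :=
  GRing.isZmodule.Build Wd dual_addA dual_addC dual_add0 dual_addN.

Let dual_scaleA a b chi : dual_scale a (dual_scale b chi) = dual_scale (a * b) chi.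
Proof. by apply: dual_eqP => x /=; rewrite /mull_scalar mulrA. Qed.
Let dual_scale1 : left_id 1 dual_scale.
Proof. by move=> f; apply: dual_eqP => x /=; rewrite /mull_scalar mul1r. Qed.
Let dual_scaleDr : right_distributive dual_scale +%R.
Proof. by move=> a f g; apply: dual_eqP => x /=; rewrite /mull_scalar mulrDr. Qed.
Let dual_scaleDl chi : {morph dual_scale^~ chi : a b / a + b}.
Proof. by move=> a b; apply: dual_eqP => x /=; rewrite /mull_scalar mulrDl. Qed.

HB.instance Definition _ := GRing.Zmodule_isLmodule.Build K Wd
  dual_scaleA dual_scale1 dual_scaleDr dual_scaleDl.

Lemma dual_addE chi eta x : (chi + eta) x = chi x + eta x. Proof. by []. Qed.
Lemma dual_zeroE x : (0 : Wd) x = 0. Proof. by []. Qed.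
Lemma dual_oppE chi x : (- chi) x = - chi x. Proof. exact: mulN1r. Qed.
Lemma dual_scaleE a chi x : (a *: chi) x = a * chi x. Proof. by []. Qed.

Definition annihilator (A : set W) : set Wd :=
  [set chi : Wd | forall x, A x -> chi x = 0].

(* The translates chi + A^\perp, for A finite-dimensional, form a neighbourhood
   basis at chi. *)
Definition dual_nbhs chi : set_system Wd :=
  filter_from (@fin_dim_subspace K W)
    (fun A => [set chi + eta | eta in annihilator A]).

HB.instance Definition _ := hasNbhs.Build Wd dual_nbhs.

Lemma fin_dim_subspace_add (A B : set W) :
  fin_dim_subspace A -> fin_dim_subspace B ->
  exists C, [/\ fin_dim_subspace C, A `<=` C & B `<=` C].
Proof.
move=> [m [u ->]] [n [v ->]].
pose w (i : 'I_(m + n)) := match fintype.split i with inl j => u j | inr k => v k end.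
have wl j : w (lshift n j) = u j by rewrite /w (unsplitK (inl _ j)).
have wr j : w (rshift m j) = v j by rewrite /w (unsplitK (inr _ j)).
exists (lin_span w); split; first by exists (m + n)%N, w.
- move=> _ [c _ <-].
  exists (fun i => match fintype.split i with inl j => c j | inr k => 0 end) => //.
  rewrite big_split_ord /= [X in _ + X]big1 ?addr0 => [|i _].
    by apply: eq_bigr => i _; rewrite wl (unsplitK (inl _ i)).
  by rewrite (unsplitK (inr _ i)) scale0r.
- move=> _ [c _ <-].
  exists (fun i => match fintype.split i with inl j => 0 | inr k => c k end) => //.
  rewrite big_split_ord /= [X in X + _]big1 ?add0r => [|i _].
    by apply: eq_bigr => i _; rewrite wr (unsplitK (inr _ i)).
  by rewrite (unsplitK (inl _ i)) scale0r.
Qed.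

Lemma fin_dim_subspace0 : exists A : set W, fin_dim_subspace A.
Proof. by exists (lin_span (fun _ : 'I_0 => 0 : W)), 0%N, (fun=> 0). Qed.

Lemma fin_dim_subspace1 (x : W) : exists2 A, fin_dim_subspace A & A x.
Proof.
exists (lin_span (fun _ : 'I_1 => x)); first by exists 1%N, (fun=> x).
by exists (fun=> 1) => //; rewrite big_ord1 scale1r.
Qed.

Let dual_nbhs_filter chi : ProperFilter (nbhs chi).
Proof.
apply: filter_from_proper; last first.
  by move=> A _; exists (chi + 0); exists 0 => // x _.
apply: filter_from_filter; first exact: fin_dim_subspace0.
move=> A B fA fB; have [C [fC AC BC]] := fin_dim_subspace_add fA fB.
exists C => // _ [eta etaC <-].
by split; exists eta => // x Ax; apply: etaC; [exact: AC|exact: BC].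
Qed.

Let dual_nbhs_singleton chi (N : set Wd) : nbhs chi N -> N chi.
Proof. by move=> [A _]; apply; exists 0; rewrite ?addr0 // => x. Qed.

Let dual_nbhs_nbhs chi (N : set Wd) : nbhs chi N -> nbhs chi (nbhs^~ N).
Proof.
move=> [A fA AN]; exists A => // _ [eta etaA <-].
exists A => // _ [theta thetaA <-]; apply: AN; exists (eta + theta).
  by move=> x Ax; rewrite dual_addE etaA // thetaA // addr0.
by rewrite addrA.
Qed.

HB.instance Definition _ := Nbhs_isNbhsTopological.Build Wd
  dual_nbhs_filter dual_nbhs_singleton dual_nbhs_nbhs.

Let dual_add_continuous : continuous (fun p : Wd * Wd => p.1 + p.2).
Proof.
move=> [chi eta] N [A fA AN].
exists ([set chi + th | th in annihilator A],
        [set eta + th | th in annihilator A]); first by split; exists A.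
move=> [f g] [/= [t1 t1A <-] [t2 t2A <-]]; apply: AN; exists (t1 + t2) => /=.
  by move=> x Ax; rewrite dual_addE t1A // t2A // addr0.
by rewrite addrACA.
Qed.

Let dual_scale_continuous :
  continuous (fun p : discrete_topology K * Wd => (p.1 : K) *: p.2).
Proof.
move=> [a chi] N [A fA AN].
exists ([set a], [set chi + th | th in annihilator A]).
  by split; [exact: (@discrete_set1 (discrete_topology K)) | exists A].
move=> [b f] [/= -> [t tA <-]]; apply: AN; exists (a *: t) => /=.
  by move=> x Ax; rewrite dual_scaleE tA // mulr0.
by rewrite scalerDr.
Qed.

HB.instance Definition _ := isTopologicalKspace.Build K Wd
  dual_add_continuous dual_scale_continuous.

Definition dual_map (psi : {linear W -> W}) chi : Wd :=
  (chi : {scalar W}) \o psi.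

Lemma dual_mapE (psi : {linear W -> W}) chi x : dual_map psi chi x = chi (psi x).
Proof. by []. Qed.

Let dual_map_is_linear psi : linear (dual_map psi).
Proof. by move=> a f g; apply: dual_eqP. Qed.

HB.instance Definition _ psi :=
  GRing.isLinear.Build K Wd Wd *:%R (dual_map psi) (@dual_map_is_linear psi).

Lemma dual_map_continuous (psi : {linear W -> W}) : continuous (dual_map psi).
Proof.
move=> chi N [A [n [v ->]] AN].
exists (lin_span (psi \o v)); first by exists n, (psi \o v).
move=> _ [eta etaA <-]; apply: AN; exists (dual_map psi eta).
  move=> _ [c _ <-]; rewrite dual_mapE; apply: etaA; exists c => //.
  by rewrite linear_sum; apply: eq_bigr => i _; rewrite linearZ.
exact/esym/linearD.
Qed.

Lemma dual_hausdorff : hausdorff_space Wd.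
Proof.
move=> chi eta ce; apply: dual_eqP => x.
have [A fA Ax] := fin_dim_subspace1 x.
have nA (f : Wd) : nbhs f [set f + th | th in annihilator A] by exists A.
have [_ [[t tA <-] [r rA]]] := ce _ _ (nA chi) (nA eta).
by move/(congr1 (fun f : Wd => f x)); rewrite !dual_addE tA // rA // !addr0.
Qed.

End DualSpace.

(* Main.v *)
Require Import Defs.
From HB Require Import structures.
From mathcomp Require Import all_boot all_order all_algebra.
From mathcomp Require Import finmap.
From mathcomp Require Import all_classical reals ereal topology.

(* The linearly compact open subspaces of the dual of W are exactly the
   annihilators of the finite-dimensional A <= W, and the cotrajectory of the
   annihilator of A under the dual map is the annihilator of the trajectory T of
   A.  A dual basis gives dim T / A = dim (annihilator A) / (annihilator T), so
   the two suprema range over limits of the same sequences. *)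

Set Implicit Arguments.
Unset Strict Implicit.
Unset Printing Implicit Defensive.

Import Order.TTheory GRing.Theory Num.Theory.

Local Open Scope classical_set_scope.
Local Open Scope ring_scope.

(** * Linear subspaces, spans and coordinates in row vectors *)

Section Subspaces.
Context (K : fieldType) (V : lmodType K).
Implicit Types (A B T : set V).

Lemma subspaceD A x y : linear_subspace A -> A x -> A y -> A (x + y).
Proof. by move=> [_ lA] Ax Ay; rewrite -[x]scale1r; apply: lA. Qed.

Lemma subspaceZ A a x : linear_subspace A -> A x -> A (a *: x).
Proof. by move=> [A0 lA] Ax; rewrite -[X in A X]addr0; apply: lA. Qed.

Lemma subspaceB A x y : linear_subspace A -> A x -> A y -> A (x - y).
Proof.
by move=> lA Ax Ay; apply: subspaceD => //; rewrite -scaleN1r; apply: subspaceZ.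
Qed.

Lemma subspace_sum A (I : finType) (F : I -> V) :
  linear_subspace A -> (forall i, A (F i)) -> A (\sum_i F i).
Proof.
by move=> lA AF; elim/big_ind: _ => //; [case: lA | move=> x y; apply: subspaceD].
Qed.

Lemma subspace_comb A n (v : 'I_n -> V) (c : 'I_n -> K) :
  linear_subspace A -> (forall i, A (v i)) -> A (\sum_i c i *: v i).
Proof. by move=> lA Av; apply: subspace_sum => // i; apply: subspaceZ. Qed.

Lemma lin_span_subspace n (v : 'I_n -> V) : linear_subspace (lin_span v).
Proof.
split; first by exists (fun=> 0) => //; rewrite big1 // => i _; rewrite scale0r.
move=> a _ _ [c _ <-] [d _ <-]; exists (fun i => a * c i + d i) => //.
rewrite scaler_sumr -big_split; apply: eq_bigr => i _.
by rewrite scalerA scalerDl.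
Qed.

Lemma fin_dim_is_subspace A : fin_dim_subspace A -> linear_subspace A.
Proof. by move=> [n [v ->]]; apply: lin_span_subspace. Qed.

Lemma lin_span_mem n (v : 'I_n -> V) i : lin_span v (v i).
Proof.
exists (fun j => (j == i)%:R) => //.
rewrite (bigD1 i) //= eqxx scale1r big1 ?addr0 // => j /negPf ->.
by rewrite scale0r.
Qed.

(** The map from K^n onto the span of [v]; pulling subspaces of [V] back along it reduces questions
    about them to matrix ranks. *)
Definition row_comb n (v : 'I_n -> V) (x : 'rV[K]_n) : V :=
  \sum_i x 0 i *: v i.

Lemma row_combP n (v : 'I_n -> V) a x y :
  row_comb v (a *: x + y) = a *: row_comb v x + row_comb v y.
Proof.
rewrite /row_comb scaler_sumr -big_split; apply: eq_bigr => i _.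
by rewrite !mxE scalerDl scalerA.
Qed.

Lemma row_comb_row n (v : 'I_n -> V) (c : 'I_n -> K) :
  row_comb v (\row_i c i) = \sum_i c i *: v i.
Proof. by apply: eq_bigr => i _; rewrite mxE. Qed.

Lemma row_comb_mul m n (v : 'I_n -> V) (x : 'rV_m) (M : 'M_(m, n)) :
  row_comb v (x *m M) = \sum_i x 0 i *: row_comb v (row i M).
Proof.
rewrite /row_comb; under [RHS]eq_bigr do rewrite scaler_sumr.
rewrite exchange_big; apply: eq_bigr => j _.
rewrite mxE scaler_suml; apply: eq_bigr => i _.
by rewrite mxE scalerA.
Qed.

Lemma row_comb_preimage_subspace A n (v : 'I_n -> V) :
  linear_subspace A -> linear_subspace [set x : 'rV[K]_n | A (row_comb v x)].
Proof.
move=> lA; split.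
  rewrite /= /row_comb big1; first by case: lA.
  by move=> i _; rewrite mxE scale0r.
by move=> a x y; rewrite /= row_combP; case: lA => _; apply.
Qed.

End Subspaces.

(** Take [M] of maximal rank among the matrices whose row space lies in [D]. Adjoining a vector of
    [D] to [M] cannot raise the rank, so that vector is already in the row space. *)
Lemma row_subspace (K : fieldType) n (D : set 'rV[K]_n) : linear_subspace D ->
  exists M : 'M[K]_n, forall x, D x <-> (x <= M)%MS.
Proof.
move=> lD.
pose P r := `[< exists M : 'M[K]_n,
  (forall x : 'rV_n, (x <= M)%MS -> D x) /\ \rank M = r >].
have exP : exists r, P r.
  exists 0%N; apply/asboolP; exists 0; split; last exact: mxrank0.
  by move=> x; rewrite submx0 => /eqP ->; case: lD.
have bdP r : P r -> (r <= n)%N by move=> /asboolP[M [_ <-]]; apply: rank_leq_row.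
case: (ex_maxnP exP bdP) => r /asboolP[M [MD <-]] rmax.
exists M => x; split => [Dx|]; last exact: MD.
apply: submx_trans (addsmxSr M x) _.
rewrite -(geq_leqif (mxrank_leqif_sup (addsmxSl M x))); apply: rmax.
apply/asboolP; exists (M + x)%MS; split=> // y /sub_addsmxP[[u1 u2] ->] /=.
apply: subspaceD => //; first by apply: MD; apply: submxMl.
by rewrite [u2]mx11_scalar mul_scalar_mx; apply: subspaceZ.
Qed.

(** * Finite-dimensional subspaces and dimensions of quotients *)

Section FiniteDimension.
Context (K : fieldType) (V : lmodType K).
Implicit Types (A B T : set V).

Lemma fin_dim_subspaceS A B : fin_dim_subspace A -> linear_subspace B ->
  B `<=` A -> fin_dim_subspace B.
Proof.
move=> [n [v ->]] lB BA.
have [M MB] := row_subspace (row_comb_preimage_subspace v lB).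
exists n, (fun i => row_comb v (row i M)); apply/seteqP; split.
  move=> y By; have [c _ cy] := BA _ By.
  move: By; rewrite -cy -row_comb_row => /MB/submxP[d ->].
  by exists (fun i => d 0 i) => //; rewrite row_comb_mul.
by move=> _ [c _ <-]; apply: subspace_comb => // i; apply/MB/row_sub.
Qed.

(** The preimage of [A] in K^n is the row space of some [M]. A row basis of a complement of [M] maps
    to a basis of [T] modulo [A]. *)
Lemma quotient_basis_exists A T : linear_subspace A -> fin_dim_subspace T ->
  exists n (v : 'I_n -> V), quotient_basis T A v.
Proof.
move=> lA [n [v ->]].
have [M MA] := row_subspace (row_comb_preimage_subspace v lA).
pose N := row_base M^C%MS.
exists _, (fun i => row_comb v (row i N)); split.
- by move=> i; exists (fun j => row i N 0 j).
- move=> c; rewrite -[X in A X](_ : row_comb v ((\row_i c i) *m N) = _); last first.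
    by rewrite row_comb_mul; apply: eq_bigr => i _; rewrite mxE.
  move=> /MA cM i.
  (* This vector lies in two complementary row spaces, so it is zero, and the rows of [N] are
     free. *)
  have : ((\row_i c i) *m N <= M :&: M^C)%MS.
    by rewrite sub_capmx cM /= -(eq_row_base M^C%MS) submxMl.
  rewrite capmx_compl submx0 mulmx_free_eq0 ?row_base_free // => /eqP/rowP/(_ i).
  by rewrite !mxE.
- move=> _ [c _ <-].
  have : (\row_i c i <= M + M^C)%MS by apply: submx_full; apply: addsmx_compl_full.
  move=> /sub_addsmxP[[u1 u2] /= cE].
  have /submxP[d dE] : (u2 *m M^C <= N)%MS by rewrite eq_row_base submxMl.
  exists (fun i => d 0 i).
  rewrite -row_comb_row -row_comb_mul -dE addrC -[- row_comb _ _]scaleN1r.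
  rewrite -row_combP cE scaleN1r addrC addrK.
  by apply/MA; apply: submxMl.
Qed.

(** The coordinates of [v] in [w] modulo [B] form an m by n matrix. Freeness of [v] makes its rows
    free, so its rank m is at most n. *)
Lemma quotient_basis_leq A B m n (v : 'I_m -> V) (w : 'I_n -> V) :
  linear_subspace B -> quotient_basis A B v -> quotient_basis A B w ->
  (m <= n)%N.
Proof.
move=> lB [vA vfree _] [wA _ wspan].
have /choice[c cE] := fun i => wspan _ (vA i).
pose M := \matrix_(i, j) c i j.
suff <- : \rank M = m by apply: rank_leq_col.
apply/eqP/inj_row_free => x xM0; apply/rowP => i; rewrite [RHS]mxE.
apply: (vfree (fun i => x 0 i)).
rewrite -[X in B X]subr0 -[X in _ - X](_ : row_comb w (x *m M) = 0); last first.
  by rewrite xM0 /row_comb big1 // => j _; rewrite mxE scale0r.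
rewrite row_comb_mul -sumrB; apply: subspace_sum => // j.
rewrite -scalerBr; apply: subspaceZ => //.
rewrite [row_comb _ _](_ : _ = \sum_i c j i *: w i) //.
by apply: eq_bigr => k _; rewrite !mxE.
Qed.

Lemma quotient_dimE (R : realType) A B n (v : 'I_n -> V) : linear_subspace B ->
  quotient_basis A B v -> quotient_dim R A B = n%:R%:E.
Proof.
move=> lB vb.
rewrite /quotient_dim (_ : [set _ | _ in _] = [set n%:R%:E]) ?ereal_inf1 //.
apply/seteqP; split=> [_ [m [w wb] <-]|_ ->]; last by exists n => //; exists v.
congr (_%:R%:E); apply/eqP.
by rewrite eqn_leq (quotient_basis_leq lB wb vb) (quotient_basis_leq lB vb wb).
Qed.

End FiniteDimension.

(* A subspace maximal among those containing B but not x is a hyperplane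
   complementing the line of x; chi is the coordinate along x. *)
Lemma separating_functional (K : fieldType) (V : lmodType K) (B : set V) x :
  linear_subspace B -> ~ B x ->
  exists chi : lefschetz_dual V, annihilator B chi /\ chi x = 1.
Proof.
move=> lB nBx.
(* The condition bears on the union with [B] so that the empty chain causes no trouble: its union is
   empty, and adding [B] gives back a subspace. *)
pose P (C : set V) := linear_subspace (B `|` C) /\ ~ C x.
have [|C [[lM nCx] Cmax]] := @Zorn_bigcup _ P.
  move=> F FP Ftot; split; last by move=> [C /FP[]].
  split; first by left; case: lB.
  move=> a y z [By|[C FC Cy]] [Bz|[D FD Dz]].
  - by left; case: lB => _; apply.
  - have [[_ lD] _] := FP _ FD.
    by have [?|?] := lD a y z (or_introl By) (or_intror Dz); [left|right; exists D].
  - have [[_ lC] _] := FP _ FC.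
    by have [?|?] := lC a y z (or_intror Cy) (or_introl Bz); [left|right; exists C].
  - wlog [E [FE Ey Ez]] : / exists E, [/\ F E, E y & E z].
      by apply; have [CD|DC] := Ftot _ _ FC FD;
        [exists D; split=> //; apply: CD | exists C; split=> //; apply: DC].
    have [[_ lE] _] := FP _ FE.
    by have [?|?] := lE a y z (or_intror Ey) (or_intror Ez); [left|right; exists E].
pose M := B `|` C.
have nMx : ~ M x by case.
have M0 : M 0 by case: lM.
have coordP y : exists a, M (y - a *: x).
  have [My|nMy] := pselect (M y); first by exists 0; rewrite scale0r subr0.
  (* [D] is generated by [M] and [y]. By maximality it contains [x], and the coefficient of [y] is
     nonzero because [x] is not in [M]; solving for [y] gives its coordinate along [x]. *)
  pose D := [set z | exists a, M (z - a *: y)].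
  have MD : M `<=` D by move=> z Mz; exists 0; rewrite scale0r subr0.
  suff [a Ma] : D x.
    have a0 : a != 0.
      by apply/eqP => a0; apply: nMx; move: Ma; rewrite a0 scale0r subr0.
    exists a^-1; rewrite -opprB -scaleN1r; apply: subspaceZ => //.
    rewrite -[y](scalerK a0) -scalerBr; exact: subspaceZ.
  apply: contrapT => nDx; apply: (Cmax D).
    split; first by move=> z Cz; apply: MD; right.
    move=> /(_ y) DC; apply: nMy; right; apply: DC.
    by exists 1; rewrite scale1r subrr.
  split=> //; rewrite (_ : B `|` D = D); last first.
    by apply/setUidPr => z Bz; apply: MD; left.
  split; first exact: MD.
  move=> a z w [b Mb] [c Mc]; exists (a * b + c).
  rewrite scalerDl -scalerA opprD addrACA -scalerBr.
  by apply: subspaceD => //; apply: subspaceZ.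
have coord_inj y a b : M (y - a *: x) -> M (y - b *: x) -> a = b.
  move=> Ma Mb; apply/eqP; rewrite -subr_eq0; apply/negP => /negP ab.
  apply: nMx; rewrite -[x](scalerK ab); apply: subspaceZ => //.
  have := subspaceB lM Mb Ma.
  by rewrite opprB addrC addrA subrK -scalerBl.
have [f fP] := choice coordP.
have fl : scalar f.
  move=> a y z; apply: (coord_inj (a *: y + z)) => //.
  rewrite scalerDl -scalerA opprD addrACA -scalerBr.
  by apply: subspaceD => //; apply: subspaceZ.
pose fL : {scalar V} := HB.pack f (GRing.isLinear.Build K V K *%R f fl).
exists fL; split=> [y By|].
  by apply: (coord_inj y) => //; rewrite scale0r subr0; left.
by apply: (coord_inj x) => //; rewrite scale1r subrr.
Qed.

(** * Annihilators in the Lefschetz dual *)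

Section Duality.
Context (K : fieldType) (W : lmodType K).
Local Notation Wd := (lefschetz_dual W).
Implicit Types (A T : set W) (chi eta : Wd) (psi : {linear W -> W}).

Lemma dual_subE chi eta x : (chi - eta) x = chi x - eta x.
Proof. by rewrite dual_addE dual_oppE. Qed.

Lemma dual_sumE n (c : 'I_n -> K) (chi : 'I_n -> Wd) x :
  (\sum_i c i *: chi i) x = \sum_i c i * chi i x.
Proof. by elim/big_rec2: _ => // i y f _ <-. Qed.

Lemma dual_combE n (c : 'I_n -> K) (v : 'I_n -> W) chi :
  chi (\sum_i c i *: v i) = \sum_i c i * chi (v i).
Proof.
by rewrite (linear_sum (chi : {scalar W})); apply: eq_bigr => i _; rewrite linearZ.
Qed.

Lemma annihilator_subspace A : linear_subspace (annihilator A).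
Proof.
split=> // a f g fA gA x Ax.
by rewrite dual_addE dual_scaleE fA // gA // mulr0 addr0.
Qed.

Lemma annihilator_span n (v : 'I_n -> W) chi :
  (forall i, chi (v i) = 0) -> annihilator (lin_span v) chi.
Proof.
by move=> chiv _ [c _ <-]; rewrite dual_combE big1 // => i _; rewrite chiv mulr0.
Qed.

(* Density of L in its double annihilator: separate the values of chi on v from
   those of L in K^n, and read the separating functional as a vector of W. *)
Lemma subspace_interpolation (L : set Wd) n (v : 'I_n -> W) chi :
  linear_subspace L ->
  (forall w, lin_span v w -> (forall eta, L eta -> eta w = 0) -> chi w = 0) ->
  exists2 eta, L eta & forall i, eta (v i) = chi (v i).
Proof.
move=> lL chi0.
pose val (eta : Wd) : 'rV[K]_n := \row_i eta (v i).
have lE : linear_subspace [set val eta | eta in L].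
  split; first by exists 0; [case: lL | apply/rowP => i; rewrite !mxE].
  move=> a _ _ [f Lf <-] [g Lg <-]; exists (a *: f + g).
    by case: lL => _; apply.
  by apply/rowP => i; rewrite !mxE dual_addE dual_scaleE.
have [[eta Leta etaE]|nE] := pselect ([set val eta | eta in L] (val chi)).
  by exists eta => // i; move/rowP/(_ i): etaE; rewrite !mxE.
have [phi [phiE phi1]] := separating_functional lE nE.
pose c i := phi (delta_mx 0 i).
have phival eta : phi (val eta) = eta (\sum_i c i *: v i).
  rewrite dual_combE [val eta]row_sum_delta (linear_sum (phi : {scalar _})) /=.
  by apply: eq_bigr => i _; rewrite linearZ mxE /= mulrC.
have /eqP := oner_neq0 K; case; rewrite -phi1 phival; apply: chi0.
  by exists c.
by move=> eta Leta; rewrite -phival; apply: phiE; exists eta.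
Qed.

Lemma open_annihilator A : fin_dim_subspace A -> open (annihilator A).
Proof.
move=> fA; rewrite openE => chi chiA; exists A => // _ [eta etaA <-].
exact: (subspaceD (annihilator_subspace A)).
Qed.

(** Openness at 0 puts the annihilator of some finite span inside [U]; let [A] be the part of that
    span killed by [U]. A functional vanishing on [A] agrees on the span with some element of [U],
    and their difference is in [U] as well. *)
Lemma open_subspace_annihilator (U : set Wd) : linear_subspace U -> open U ->
  exists2 A, fin_dim_subspace A & U = annihilator A.
Proof.
move=> lU; rewrite openE => /(_ 0) []; first by case: lU.
move=> _ [n [v ->]] vU.
have {}vU : annihilator (lin_span v) `<=` U.
  by move=> chi chiv; apply: vU; exists chi => //; rewrite add0r.
pose A := [set w | lin_span v w /\ forall eta, U eta -> eta w = 0].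
exists A.
  apply: (@fin_dim_subspaceS _ _ (lin_span v)); first by exists n, v.
    split; first by split; [case: (lin_span_subspace v) | move=> eta _; exact: linear0].
    move=> a x y [vx Ux] [vy Uy]; split; first by case: (lin_span_subspace v) => _; apply.
    by move=> eta Ueta; rewrite (linearP (eta : {scalar W})) Ux // Uy // mulr0 addr0.
  by move=> w [].
apply/seteqP; split=> [chi Uchi w [_]|chi chiA]; first exact.
have [w vw w0|eta Ueta etav] := subspace_interpolation (v := v) (chi := chi) lU.
  exact: chiA.
rewrite -[chi](subrK eta); apply: subspaceD => //; apply: vU.
by apply: annihilator_span => i; rewrite dual_subE etav subrr.
Qed.

Lemma nbhs_subspace_annihilator A chi (N : set Wd) : annihilator A chi ->
  nbhs (chi : subspace (annihilator A)) (N : set (subspace (annihilator A))) <->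
  exists2 B, fin_dim_subspace B &
    forall eta, annihilator A eta -> annihilator B (eta - chi) -> N eta.
Proof.
move=> chiA; rewrite /nbhs /= -(nbhs_subspace_in chiA); split=> -[B fB BN]; exists B => //.
  move=> eta etaA etaB; apply: BN etaA; exists (eta - chi) => //.
  by rewrite addrC subrK.
move=> _ [eta etaB <-] etaA; apply: BN => //.
by rewrite addrC addKr.
Qed.

Lemma annihilator_linearly_topologized A : linearly_topologized (annihilator A).
Proof.
split; first exact: annihilator_subspace.
  by apply: subspace_hausdorff; apply: dual_hausdorff.
have A0 : annihilator A 0 by [].
move=> N /(nbhs_subspace_annihilator _ A0)[B fB BN].
(* The annihilator of a union is the intersection of the annihilators, here the trace on
   [annihilator A] of a basic neighbourhood of 0. *)
exists (annihilator (A `|` B)); split.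
- exact: annihilator_subspace.
- by move=> chi chiAB x Ax; apply: chiAB; left.
- apply/(nbhs_subspace_annihilator _ A0); exists B => // eta etaA.
  by rewrite subr0 => etaB x [/etaA|/etaB].
- move=> chi chiAB; apply: BN => [x Ax|]; first by apply: chiAB; left.
  by rewrite subr0 => x Bx; apply: chiAB; right.
Qed.

(* A member of F prescribes the values of its points on some vectors of W.  By
   the finite intersection property the prescribed pairs (w, a) span a subspace
   G of W * K that misses (0, 1), i.e. the graph of a function; a functional
   separating (0, 1) from G yields a chi with all prescribed values, and chi
   lies in every member of F because these are closed. *)
Lemma annihilator_linearly_compact A : linearly_compact (annihilator A).
Proof.
split; first exact: annihilator_linearly_topologized.
move=> F FP Ffin.
pose prescribed (D : {fset set Wd}) (p : W * K^o) :=
  forall chi, (forall C, C \in D -> C chi) -> chi p.1 = p.2.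
pose G := [set p | exists2 D : {fset set Wd}, {subset D <= F} & prescribed D p].
have lG : linear_subspace G.
  split; first by exists fset0 => // chi _; exact: linear0.
  move=> a p q [D DF Dp] [E EF Eq]; exists (D `|` E)%fset.
    by move=> C; rewrite in_fsetU => /orP[/DF|/EF].
  move=> chi chiDE; rewrite /= (linearP (chi : {scalar W})) Dp ?Eq // => C CD;
    by apply: chiDE; rewrite in_fsetU CD ?orbT.
have nG : ~ G (0, 1).
  (* A common point of the members of [D] would take the value 1 at the vector 0. *)
  move=> [D /Ffin[chi chiD] /(_ chi chiD) /=].
  by rewrite (linear0 (chi : {scalar W})) => /esym/eqP; rewrite oner_eq0.
have [Phi [PhiG Phi1]] := separating_functional lG nG.
(* Since [Phi (0, 1) = 1], the vanishing of [Phi] at [(w, a)] means that [a] equals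
   [- Phi (w, 0)]. *)
pose f w := - Phi (w, 0).
have fl : scalar f.
  move=> a x y; rewrite /f mulrN -opprD; congr (- _).
  rewrite -(linearP (Phi : {scalar _})); congr (Phi (_, _)).
  by rewrite /= scaler0 addr0.
pose chi : {scalar W} := HB.pack f (GRing.isLinear.Build K W K *%R f fl).
have chiG w a : G (w, a) -> chi w = a.
  move=> /PhiG; rewrite [(w, a)](_ : _ = a *: (0, 1) + (w, 0)); last first.
    by congr (_, _); rewrite /= ?scaler0 ?add0r // addr0 [RHS]mulr1.
  by rewrite (linearP (Phi : {scalar _})) Phi1 mulr1 => /eqP; rewrite addr_eq0 => /eqP.
exists chi => C FC; have [[x [L [lL CE]]] CA Ccl] := FP C FC.
have chiC w b : (forall eta, C eta -> eta w = b) -> chi w = b.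
  move=> Cw; apply: chiG; exists [fset C]%fset.
    by move=> D; rewrite in_fset1 => /eqP ->; rewrite inE.
  by move=> eta etaC; apply: Cw; apply: etaC; rewrite in_fset1.
have chiA : annihilator A chi.
  by move=> w Aw; apply: chiC => eta /CA; apply.
apply: Ccl => N /(nbhs_subspace_annihilator _ chiA)[_ [n [v ->]] vN].
(* Interpolation applies: if [L] vanishes at [w], all points of the coset [C] of [L] share the value
   [x w] there, so [chi] has this prescribed value too. Hence [C] meets the neighbourhood of [chi]
   given by [v]. *)
have [w _ Lw|eta Leta etav] :=
    subspace_interpolation (v := v) (chi := (chi : Wd) - x) lL.
  rewrite dual_subE (chiC w (x w)) ?subrr // CE => _ [eta Leta <-].
  by rewrite dual_addE (Lw _ Leta) addr0.
have Cxe : C (x + eta) by rewrite CE; exists eta.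
exists (x + eta); split=> //; apply: vN; first exact: CA.
apply: annihilator_span => i; rewrite dual_subE dual_addE etav dual_subE.
by rewrite addrCA subrr addr0 subrr.
Qed.

(** The [chi j] kill [A] and are dual to [v]. Evaluating at the [v i], which lie in [T], recovers
    the coefficients of a combination; and any [f] killing [A] agrees on [T] with the combination of
    coefficients [f (v i)]. *)
Lemma dual_quotient_basis A T n (v : 'I_n -> W) : linear_subspace A ->
  A `<=` T -> quotient_basis T A v ->
  exists chi : 'I_n -> Wd,
    quotient_basis (annihilator A) (annihilator T) chi.
Proof.
move=> lA AT [Tv vfree vspan].
have /choice[chi chiP] : forall j, exists chi : Wd,
    annihilator A chi /\ forall i, chi (v i) = (i == j)%:R.
  move=> j.
  (* Modulo [A], [B] is the span of the [v i] with [i] different from [j]. *)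
  pose B := [set w | exists2 c : 'I_n -> K, c j = 0 & A (w - \sum_i c i *: v i)].
  have lB : linear_subspace B.
    split.
      exists (fun=> 0) => //; rewrite big1 ?subrr; first by case: lA.
      by move=> i _; rewrite scale0r.
    move=> a x y [c cj Ac] [d dj Ad]; exists (fun i => a * c i + d i).
      by rewrite cj dj mulr0 addr0.
    rewrite [X in A X](_ : _ = a *: (x - \sum_i c i *: v i) +
        (y - \sum_i d i *: v i)); first by case: lA => _; apply.
    rewrite scalerBr addrACA -opprD scaler_sumr -big_split; congr (_ - _).
    by apply: eq_bigr => i _; rewrite scalerDl scalerA.
  have nBv : ~ B (v j).
    move=> [c cj Ac].
    have : A (\sum_i ((i == j)%:R - c i) *: v i).
      under eq_bigr do rewrite scalerBl.
      rewrite sumrB (bigD1 j) //= eqxx scale1r big1 ?addr0 // => i /negPf ->.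
      by rewrite scale0r.
    by move/vfree/(_ j)/eqP; rewrite eqxx cj subr0 oner_eq0.
  have [chi [chiB chi1]] := separating_functional lB nBv.
  exists chi; split=> [w Aw|i].
    apply: chiB; exists (fun=> 0) => //.
    by rewrite big1 ?subr0 // => i _; rewrite scale0r.
  have [->|ij] := eqVneq i j; first exact: chi1.
  apply: chiB; exists (fun k => (k == i)%:R); first by rewrite eq_sym (negPf ij).
  rewrite (bigD1 i) //= eqxx scale1r big1 ?addr0 ?subrr; first by case: lA.
  by move=> k /negPf ->; rewrite scale0r.
have chi_comb c i : (\sum_j c j *: chi j) (v i) = c i.
  rewrite dual_sumE (bigD1 i) //= (chiP i).2 eqxx mulr1 big1 ?addr0 // => j ji.
  by rewrite (chiP j).2 eq_sym (negPf ji) mulr0.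
exists chi; split=> [i|c cT i|f fA]; first exact: (chiP i).1.
  by rewrite -(chi_comb c i); apply: cT.
exists (fun i => f (v i)) => t Tt; have [c Ac] := vspan t Tt.
have fA' : annihilator A (f - \sum_i f (v i) *: chi i).
  apply: (subspaceB (annihilator_subspace A)) => //.
  apply: (subspace_comb _ (annihilator_subspace A)) => i.
  by case: (chiP i).
rewrite -[t](subrK (\sum_i c i *: v i)) (linearD (_ : {scalar W})) fA' // add0r.
by rewrite dual_combE big1 // => i _; rewrite dual_subE chi_comb subrr mulr0.
Qed.

Lemma quotient_dim_annihilator (R : realType) A T : linear_subspace A ->
  fin_dim_subspace T -> A `<=` T ->
  quotient_dim R (annihilator A) (annihilator T) = quotient_dim R T A.
Proof.
move=> lA fT AT; have [n [v vb]] := quotient_basis_exists lA fT.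
have [chi chib] := dual_quotient_basis lA AT vb.
rewrite (quotient_dimE R lA vb) (quotient_dimE R _ chib) //.
exact: annihilator_subspace.
Qed.

(** * Trajectories, cotrajectories and the terms of the entropy sequences *)

Lemma fin_dim_trajectory psi A n : fin_dim_subspace A ->
  fin_dim_subspace (trajectory psi A n).
Proof.
move=> fA; have lA := fin_dim_is_subspace fA.
(* The trajectory is a subspace of any subspace [B] containing the first [n] iterated images of [A],
   and a finite-dimensional such [B] is built by induction. *)
have [B fB AB] : exists2 B, fin_dim_subspace B &
    forall i, (i < n)%N -> iter i psi @` A `<=` B.
  elim: n => [|n [B fB AB]].
    by have [B fB] := fin_dim_subspace0 W; exists B.
  have fAn : fin_dim_subspace (iter n psi @` A).
    case: fA => m [v ->]; exists m, (iter n psi \o v); apply/seteqP.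
    have iterE c : iter n psi (\sum_i c i *: v i) = \sum_i c i *: iter n psi (v i).
      elim: n {AB} => //= n ->; rewrite linear_sum.
      by apply: eq_bigr => i _; rewrite linearZ.
    split=> [_ [_ [c _ <-] <-]|_ [c _ <-]]; first by exists c.
    by exists (\sum_i c i *: v i) => //; exists c.
  have [C [fC BC AC]] := fin_dim_subspace_add fB fAn.
  exists C => // i; rewrite ltnS leq_eqVlt => /orP[/eqP -> //|/AB iB].
  exact: subset_trans iB BC.
apply: (fin_dim_subspaceS fB).
  have iterP i : forall a x y, iter i psi (a *: x + y) = a *: iter i psi x + iter i psi y.
    by move=> a x y; elim: i => //= i ->; rewrite linearP.
  split.
    exists (fun=> 0); first by move=> i; case: lA.
    rewrite big1 // => i _.
    by have := iterP i (-1) 0 0; rewrite scaler0 addr0 scaleN1r addNr.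
  move=> a _ _ [u uA <-] [w wA <-]; exists (fun i => a *: u i + w i).
    by move=> i; case: lA => _; apply.
  by rewrite scaler_sumr -big_split; apply: eq_bigr => i _; rewrite iterP.
move=> _ [u uA <-]; apply: subspace_sum; first exact: fin_dim_is_subspace.
by move=> i; apply: (AB i) => //; exists (u i).
Qed.

Lemma iter0 psi n : iter n psi 0 = 0.
Proof. by elim: n => //= n ->; rewrite linear0. Qed.

Lemma iter_dual_mapE psi n chi x : iter n (dual_map psi) chi x = chi (iter n psi x).
Proof. by elim: n x => // n IH x; rewrite iterS dual_mapE IH -iterSr. Qed.

Lemma trajectory_mem psi A n i x : A 0 -> A x -> (i < n)%N ->
  trajectory psi A n (iter i psi x).
Proof.
move=> A0 Ax ltin; exists (fun j => if j == i :> nat then x else 0).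
  by move=> j; case: ifP.
rewrite (bigD1 (Ordinal ltin)) //= eqxx big1 ?addr0 // => j ji.
by rewrite ifN ?iter0.
Qed.

(** The i-th iterate of the dual map sends [chi] into the annihilator of [A] exactly when [chi]
    kills the i-th image of [A], and these images generate the trajectory. *)
Lemma cotrajectory_annihilator psi A n : A 0 ->
  cotrajectory (dual_map psi) (annihilator A) n = annihilator (trajectory psi A n).
Proof.
move=> A0; apply/seteqP; split=> [chi chiA _ [u uA <-]|chi chiT i ltin x Ax].
  rewrite (linear_sum (chi : {scalar W})) big1 // => i _.
  by rewrite -iter_dual_mapE; apply: chiA; rewrite /=.
by rewrite iter_dual_mapE; apply: chiT; apply: trajectory_mem.
Qed.

Lemma ent_termE (R : realType) psi A (n : nat) : fin_dim_subspace A ->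
  ((n%:R^-1)%:E * quotient_dim R (trajectory psi A n) A)%E =
  ((n%:R^-1)%:E * quotient_dim R (annihilator A)
     (cotrajectory (dual_map psi) (annihilator A) n))%E.
Proof.
(* For [n = 0] the trajectory is zero and need not contain [A], but both factors [0^-1] are 0. *)
move=> fA; case: n => [|n]; first by rewrite invr0 !mul0e.
have lA := fin_dim_is_subspace fA; have [A0 _] := lA.
rewrite cotrajectory_annihilator // quotient_dim_annihilator //.
  exact: fin_dim_trajectory.
(* For positive length, [A] is the image under the 0-th iterate. *)
by move=> x Ax; apply: (@trajectory_mem psi A n.+1 0 x).
Qed.

End Duality.

Theorem mainTheorem4 (R : realType) (K : fieldType) (W : lmodType K)
    (psi : {linear W -> W}) :
  ent R psi = ent_star R (dual_map psi).
Proof.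
congr ereal_sup; apply/seteqP; split=> [_ [A fA <-]|_ [U [[[lU _ _] _] oU] <-]].
  exists (annihilator A).
    by split; [exact: annihilator_linearly_compact | exact: open_annihilator].
  by congr (lim (_ @ \oo)); apply/funext => n; rewrite ent_termE.
have [A fA ->] := open_subspace_annihilator lU oU; exists A => //.
by congr (lim (_ @ \oo)); apply/funext => n; rewrite ent_termE.
Qed.
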